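(* Let $F$ be a field, $b,c\in F$, and let $f(x)=x^2+bx+c\in F[x]$ be irreducible with a root $\alpha\in F(\sqrt{\Delta})\setminus F$, where $\Delta=b^2-4c$. Let $m$ be a positive integer. Then $\alpha\in F(\sqrt{\Delta})^m$ (i.e. $\alpha=\gamma^m$ for some $\gamma\in F(\sqrt{\Delta})$) if and only if there exist $n,t\in F$ with $c=n^m$ and $b=-D_m(t,n)$.
   Context: The Dickson polynomials of the first kind are defined by $D_1(t,n)=t$, $D_2(t,n)=t^2-2n$, $D_k(t,n)=tD_{k-1}(t,n)-nD_{k-2}(t,n)$ for $k>2$. *)

(* Defs.v *)
From HB Require Import structures.
From mathcomp Require Import all_boot all_order all_algebra all_field.

Set Implicit Arguments.
Unset Strict Implicit.
Unset Printing Implicit Defensive.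

Import GRing.Theory.
Local Open Scope ring_scope.

(* D_k(t, n) is defined for k >= 1; the value 2 at k = 0 is the usual
   convention, compatible with the recurrence. *)
Fixpoint dickson (R : comNzRingType) (k : nat) (t n : R) : R :=
  match k with
  | 0 => 2%:R
  | 1 => t
  | 2 => t ^+ 2 - 2%:R * n
  | (k''.+1 as k').+1 => t * dickson k' t n - n * dickson k'' t n
  end.

Definition monic_quadratic (F : fieldType) (b c : F) : {poly F} :=
  'X^2 + b *: 'X + c%:P.

Definition quadratic_disc (F : fieldType) (b c : F) : F :=
  b ^+ 2 - 4%:R * c.

(* Main.v *)
Require Import Defs.
From HB Require Import structures.
From mathcomp Require Import all_boot all_order all_algebra all_field ring.

Set Implicit Arguments.
Unset Strict Implicit.
Unset Printing Implicit Defensive.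

Import GRing.Theory.
Local Open Scope ring_scope.

(** If gamma satisfies [X^2 - t X + n], with conjugate [t - gamma], then
    [gamma ^+ m] and its conjugate have product [n ^+ m] and sum [D_m(t, n)], so
    [gamma ^+ m] is a root of [X^2 - D_m(t, n) X + n ^+ m].  When [gamma ^+ m]
    is [alpha], comparing with [X^2 + b X + c] gives one direction, as [alpha] is
    not in [F].  Conversely [D_m(t, n)^2 - 4 n^m = (t^2 - 4 n) U^2], where [U] is
    the companion Lucas sequence, so [sqrt (t^2 - 4 n) = delta / U] lies in
    [F(sqrt Delta)] and hence so do the roots of [X^2 - t X + n]; their m-th
    powers are the two roots of [X^2 + b X + c]. *)

(** Since D_0 = 2, the separate branch at k = 2 also obeys the recurrence. *)
Lemma dicksonSS (R : comNzRingType) (k : nat) (t n : R) :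
  dickson k.+2 t n = t * dickson k.+1 t n - n * dickson k t n.
Proof. by case: k => //=; ring. Qed.

Lemma dickson_morph (R S : comNzRingType) (f : {rmorphism R -> S}) (k : nat)
  (t n : R) : dickson k (f t) (f n) = f (dickson k t n).
Proof.
suff [] : dickson k (f t) (f n) = f (dickson k t n) /\
          dickson k.+1 (f t) (f n) = f (dickson k.+1 t n) by [].
elim: k => [|k [IH0 IH1]]; first by rewrite /= rmorph_nat.
by split=> //; rewrite !dicksonSS IH0 IH1 rmorphB !rmorphM.
Qed.

(** Power sums obey the same recurrence, because x and y are the roots of X^2 - (x + y) X + x y. *)
Lemma dickson_sum_powers (R : comNzRingType) (k : nat) (x y : R) :
  dickson k (x + y) (x * y) = x ^+ k + y ^+ k.
Proof.
suff [] : dickson k (x + y) (x * y) = x ^+ k + y ^+ k /\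
          dickson k.+1 (x + y) (x * y) = x ^+ k.+1 + y ^+ k.+1 by [].
elim: k => [|k [IH0 IH1]]; first by rewrite /= !expr0 !expr1.
by split=> //; rewrite dicksonSS IH0 IH1 !exprS; ring.
Qed.

(* The second conjunct, on consecutive terms, makes the induction go through. *)
Lemma dickson_disc (R : comNzRingType) (k : nat) (t n : R) :
  exists u v : R,
    [/\ dickson k t n ^+ 2 - 4%:R * n ^+ k = (t ^+ 2 - 4%:R * n) * u ^+ 2,
        dickson k.+1 t n * dickson k t n - 2%:R * n ^+ k * t
          = (t ^+ 2 - 4%:R * n) * (v * u)
      & dickson k.+1 t n ^+ 2 - 4%:R * n ^+ k.+1
          = (t ^+ 2 - 4%:R * n) * v ^+ 2].
Proof.
elim: k => [|k [u [v [E0 E1 E2]]]].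
  (* Lucas sequence: U_0 = 0, U_1 = 1, then U_(k+2) = t U_(k+1) - n U_k. *)
  by exists 0, 1; split=> /=; rewrite ?expr0 ?expr1; ring.
exists v, (t * v - n * u); rewrite dicksonSS; split=> //.
  transitivity (t * (dickson k.+1 t n ^+ 2 - 4%:R * n ^+ k.+1)
    - n * (dickson k.+1 t n * dickson k t n - 2%:R * n ^+ k * t)).
    by rewrite !exprS; ring.
  by rewrite E1 E2; ring.
transitivity (t ^+ 2 * (dickson k.+1 t n ^+ 2 - 4%:R * n ^+ k.+1)
  - 2%:R * t * n * (dickson k.+1 t n * dickson k t n - 2%:R * n ^+ k * t)
  + n ^+ 2 * (dickson k t n ^+ 2 - 4%:R * n ^+ k)).
  by rewrite !exprS; ring.
by rewrite E0 E1 E2; ring.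
Qed.

(** Horner evaluation, replacing [delta ^+ 2] by d at each step, keeps the value linear in
    [delta]. *)
Lemma mem_Fadjoin_sqrt (F : fieldType) (L : fieldExtType F) (d : F)
    (delta gamma : L) :
  delta ^+ 2 = d%:A -> gamma \in <<1; delta>>%VS ->
  exists x y : F, gamma = x%:A + y%:A * delta.
Proof.
move=> hd /Fadjoin_polyP [p p1 ->]; elim/poly_ind: p p1 => [|p a IH] p1.
  by exists 0, 0; rewrite horner0 !scale0r mul0r addr0.
have /IH [x [y E]] : p \is a polyOver 1%VS.
  apply/polyOverP => i; have /polyOverP/(_ i.+1) := p1.
  by rewrite coefD coefMX coefC /= addr0.
have /vlineP [z Ez] : a \in 1%VS.
  by have /polyOverP/(_ 0) := p1; rewrite coefD coefMX coefC /= add0r.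
exists (z + y * d), x; rewrite hornerMXaddC E Ez -!in_algE rmorphD rmorphM /=.
by rewrite -hd; ring.
Qed.

Lemma notin1_lin_indep (F : fieldType) (L : fieldExtType F) (alpha : L)
    (x y : F) :
  alpha \notin 1%VS -> x%:A * alpha + y%:A = 0 -> x = 0 /\ y = 0.
Proof.
move=> aF; have [->|x0] := eqVneq x 0.
  rewrite scale0r mul0r add0r => /eqP; rewrite scaler_eq0 oner_eq0 orbF.
  by move/eqP.
move=> /eqP; rewrite addr_eq0 mulr_algl => /eqP E; case/negP: aF.
apply/vlineP; exists (x^-1 * - y).
by rewrite -scalerA scaleNr -E scalerA mulVf // scale1r.
Qed.

(* F(sqrt Delta) is the subfield <<1; delta>> generated over F by a square root
   delta of Delta, inside an arbitrary finite extension L of F; the subfield 1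
   of L is the image of F. *)
Theorem theorem3p1 (F : fieldType) (b c : F) (L : fieldExtType F)
    (delta alpha : L) (m : nat)
    (hirr : irreducible_poly (monic_quadratic b c))
    (hdelta : delta ^+ 2 = (quadratic_disc b c)%:A)
    (hroot : root (map_poly (in_alg L) (monic_quadratic b c)) alpha)
    (halpha : alpha \in <<1; delta>>%VS)
    (halphaF : alpha \notin 1%VS)
    (hm : (0 < m)%N) :
  (exists2 gamma : L, gamma \in <<1; delta>>%VS & alpha = gamma ^+ m)
  <-> (exists n t : F, c = n ^+ m /\ b = - dickson m t n).
Proof.
have deltaF : delta \notin 1%VS.
  apply: contra halphaF => d1; suff /subvP -> : (<<1; delta>> <= 1)%VS by [].
  by apply/FadjoinP; rewrite subvv.
(* In characteristic 2, Delta = b^2, which would force [delta] = b in F. *)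
have two0 : 2%:R != 0 :> F.
  apply: contra deltaF => /eqP two0; apply/vlineP; exists b.
  have : (delta - b%:A) ^+ 2 = 0.
    have two0L : 2%:R = 0 :> L by rewrite -(rmorph_nat (in_alg L)) two0 rmorph0.
    have -> : (delta - b%:A) ^+ 2
      = delta ^+ 2 - b%:A ^+ 2 + 2%:R * (b%:A ^+ 2 - delta * b%:A) by ring.
    rewrite hdelta two0L /quadratic_disc (_ : 4%:R = 2%:R * 2%:R) -?natrM //.
    by rewrite natrM two0 !mul0r subr0 addr0 -!in_algE rmorphXn subrr.
  by move/eqP; rewrite expf_eq0 subr_eq0 => /andP [_ /eqP].
have two0L : 2%:R != 0 :> L by rewrite -(rmorph_nat (in_alg L)) fmorph_eq0.
have four0L : 4%:R != 0 :> L by rewrite (natrM L 2 2) mulf_neq0.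
have alphaE : alpha ^+ 2 + b%:A * alpha + c%:A = 0.
  move/rootP: hroot; rewrite /monic_quadratic !rmorphD /= map_polyZ !map_polyXn.
  by rewrite map_polyX map_polyC !hornerE mulr_algl.
split=> [[gamma hgamma Ea] | [n [t [Ec Eb]]]].
  have [x [y Eg]] := mem_Fadjoin_sqrt hdelta hgamma.
  (* The norm and trace of [gamma]; [gamma'] is its conjugate. *)
  pose n := x ^+ 2 - y ^+ 2 * quadratic_disc b c; pose t := 2%:R * x.
  pose gamma' := x%:A - y%:A * delta.
  have sumE : gamma + gamma' = t%:A.
    by rewrite Eg /gamma' /t -!in_algE rmorphM rmorph_nat; ring.
  have prodE : gamma * gamma' = n%:A.
    rewrite Eg /gamma' /n -!in_algE rmorphB !rmorphM /= -hdelta.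
    by ring.
  have := dickson_sum_powers m gamma gamma'.
  rewrite sumE prodE -!in_algE dickson_morph -Ea => sumD.
  have prodD : alpha * gamma' ^+ m = (n ^+ m)%:A.
    by rewrite Ea -exprMn prodE -!in_algE rmorphXn.
  (* Two monic quadratics over F vanish at [alpha]; their difference is linear, so its coefficients
     are zero. *)
  have /(notin1_lin_indep halphaF) [] :
      (b + dickson m t n)%:A * alpha + (c - n ^+ m)%:A = 0.
    rewrite -alphaE -!in_algE rmorphD rmorphB sumD /= -prodD.
    by ring.
  move=> /eqP; rewrite addr_eq0 => /eqP Eb /eqP; rewrite subr_eq0 => /eqP Ec.
  by exists n, t.
have [u [v [disc _ _]]] := dickson_disc m t n.
have discE : quadratic_disc b c = (t ^+ 2 - 4%:R * n) * u ^+ 2.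
  by rewrite -disc /quadratic_disc Eb Ec sqrrN.
(* If u = 0 then Delta = 0, so [delta] = 0 lies in F. *)
have u0 : u != 0.
  apply: contra deltaF => /eqP u0.
  have /eqP := hdelta; rewrite discE u0 expr0n mulr0 scale0r expf_eq0 /=.
  by move=> /eqP ->; apply: mem0v.
have uL0 : in_alg L u != 0 by rewrite fmorph_eq0.
(* Quadratic formula for X^2 - t X + n: [delta / u%:A] squares to t^2 - 4 n, and s is the sign 1 or
   -1. *)
pose root_of (s : L) := (t%:A + s * (delta / u%:A)) / 2%:R.
have root_in s : s \in 1%VS -> root_of s \in <<1; delta>>%VS.
  move=> s1; have sK := subvP (subv_adjoin 1 delta) _ s1.
  have algK z : z%:A \in <<1; delta>>%VS by rewrite memvZ ?mem1v.
  rewrite /root_of rpredM ?rpredV ?rpred_nat // rpredD ?algK //.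
  by rewrite rpredM // rpredM ?memv_adjoin // rpredV algK.
have sumE : root_of 1 + root_of (- 1) = t%:A.
  by rewrite /root_of; field; rewrite two0L.
have prodE : root_of 1 * root_of (- 1) = n%:A.
  have -> : root_of 1 * root_of (- 1)
     = (t%:A ^+ 2 - delta ^+ 2 / u%:A ^+ 2) / 4%:R.
    by rewrite /root_of; field; rewrite four0L two0L andbT.
  rewrite hdelta discE -!in_algE !(rmorphM, rmorphB) rmorph_nat /=.
  by field; rewrite four0L.
(* This product is X^2 + b X + c evaluated at [alpha]; whichever factor vanishes fixes the sign. *)
have /eqP : (alpha - root_of 1 ^+ m) * (alpha - root_of (- 1) ^+ m) = 0.
  have := dickson_sum_powers m (root_of 1) (root_of (- 1)).
  rewrite sumE prodE -!in_algE dickson_morph => sumD.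
  have -> : (alpha - root_of 1 ^+ m) * (alpha - root_of (- 1) ^+ m)
    = alpha ^+ 2 - (root_of 1 ^+ m + root_of (- 1) ^+ m) * alpha
      + root_of 1 ^+ m * root_of (- 1) ^+ m by ring.
  rewrite -exprMn prodE -sumD -alphaE Eb Ec -!in_algE rmorphN rmorphXn.
  by ring.
rewrite mulf_eq0 !subr_eq0 => /orP [] /eqP Ea.
  by exists (root_of 1) => //; apply: root_in; rewrite mem1v.
by exists (root_of (- 1)) => //; apply: root_in; rewrite rpredN mem1v.
Qed.
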